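(* Let Problem (P), the tolerance $\varepsilon>0$, the parameter $\lambda\in(0,1/2]$, and the iterative method (the ''Algorithm'') be as described in the context. Then the Algorithm terminates after at most $$K=\sum_{i\in[p]}\sum_{k=0}^{S_i}2^{k\,l_i}$$ iterations, where $$S_i=\left\lceil\log_{(1-\lambda)}\left(\frac{\varepsilon}{L_i\,\|\bar{x}_{I_i}-\underline{x}_{I_i}\|}\right)\right\rceil\quad\text{for } i\in[p].$$
   Context: **Problem (P).** $\min_x c^\top x$ subject to $Ax\ge b$, $\underline{x}\le x\le \bar{x}$, $x\in\mathbb{R}^n\times\mathbb{Z}^m$, and $f_i(x_{I_i})=x_{r_i}$ for $i\in[p]:=\{1,\dots,p\}$. Here $c\in\mathbb{R}^{n+m}$, $A\in\mathbb{R}^{q\times(n+m)}$, $b\in\mathbb{R}^q$, and $\underline{x},\bar{x}\in\mathbb{R}^n\times\mathbb{Z}^m$ are finite bounds. For each $i$: $I_i\subset[n]:=\{1,\dots,n\}$, $l_i=|I_i|$, $r_i\in[n]\setminus I_i$, and $f_i:\mathbb{R}^{l_i}\to\mathbb{R}$ is Lipschitz continuous. Write $x_{\mathcal{I}_i}=(x_{I_i},x_{r_i})\in\mathbb{R}^{l_i+1}$. **Boxes.** For $\underline{v}\le\bar{v}$ in $\mathbb{R}^d$, $B(\underline{v},\bar{v})=\{x\in\mathbb{R}^d:\underline{v}\le x\le\bar{v}\}$ (componentwise). For a point $x$ with $\underline v<x<\bar v$ the split of the box is $S(\underline{v},\bar{v},x)=\{B(\underline{w},\bar{w}) : (\underline{w}_\ell=\underline{v}_\ell\wedge\bar{w}_\ell=x_\ell)\vee(\underline{w}_\ell=x_\ell\wedge\bar{w}_\ell=\bar{v}_\ell)\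 \text{for all } \ell\in\{1,\dots,d\}\}$. **Relaxation.** $L_i$ is the Lipschitz constant of $f_i$ on $B(\underline{x}_{I_i},\bar{x}_{I_i})$ with respect to a given norm $\|\cdot\|$ on $\mathbb{R}^{l_i}$, where any (weighted) norm can be used. In iteration $k$, for each $i$ there is a finite set of boxes $\mathcal{X}_i^k=\{B(\underline{v}_i^k(j),\bar{v}_i^k(j)) : j\in J_i^k\}$ in $\mathbb{R}^{l_i}$. With $m_i^k(j)=\frac12(\underline{v}_i^k(j)+\bar{v}_i^k(j))$ let $\Omega_i^k(j)=\{(x_{I_i},x_{r_i})\in\mathbb{R}^{l_i+1}: \underline{v}_i^k(j)\le x_{I_i}\le\bar{v}_i^k(j),\ |x_{r_i}-f_i(m_i^k(j))|\le\frac12L_i\|\bar{v}_i^k(j)-\underline{v}_i^k(j)\|\}$ and $\Omega_i^k=\bigcup_{j\in J_i^k}\Omega_i^k(j)$. For fixed $\lambda\in(0,1/2]$ let $\tilde\Omega_i^k(j)=\Omega_i^k(j)\cap\{(x_{I_i},x_{r_i})\in\mathbb{R}^{l_i+1} : (1-\lambda)\underline{v}_i^k(j)+\lambda\bar{v}_i^k(j)\le x_{I_i}\le\lambda\underline{v}_i^k(j)+(1-\lambda)\bar{v}_i^k(j)\}$. **Master problem M($k$).** $\min_x c^\top x$ s.t. $Ax\ge b$, $\underline{x}\le x\le\bar{x}$, $x\in\mathbb{R}^n\times\mathbb{Z}^m$, $x_{\mathcal{I}_i}\in\Omega_i^k$ for $i\in[p]$. **Subproblem S($k$).** $\min_{\tilde{x}}\|\tilde{x}-x^k\|_2^2$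 s.t. $f_i(\tilde{x}_{I_i})=\tilde{x}_{r_i}$, $\tilde{x}_{\mathcal{I}_i}\in\tilde\Omega_i^k(j_i^k)$ for $i\in[p]$. **Algorithm.** Initialize $\mathcal{X}_i^0=\{B(\underline{x}_{I_i},\bar{x}_{I_i})\}$ for all $i\in[p]$. For $k=0,1,2,\dots$: 1. Solve M($k$) to global optimality. If it is infeasible, stop and report that (P) is infeasible. Otherwise let $x^k$ denote the optimal solution of M($k$). 2. If $|f_i(x^k_{I_i})-x^k_{r_i}|\le\varepsilon$ for all $i\in[p]$, stop and return $x^k$. 3. For each $i\in[p]$ determine $j_i^k\in J_i^k$ with $x^k_{\mathcal{I}_i}\in\Omega_i^k(j_i^k)$. 4. Solve S($k$) and let $\tilde{x}^k$ denote the optimal solution. 5. For each $i\in[p]$: if $|f_i(x^k_{I_i})-x^k_{r_i}|>\varepsilon$, set $\mathcal{X}_i^{k+1}=(\mathcal{X}_i^k\setminus\{B(\underline{v}_i^k(j_i^k),\bar{v}_i^k(j_i^k))\})\cup S(\underline{v}_i^k(j_i^k),\bar{v}_i^k(j_i^k),\tilde{x}^k_{I_i})$; otherwise $\mathcal{X}_i^{k+1}=\mathcal{X}_i^k$.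
   Formalization: The norms are additionally assumed monotone on boxes (|u_j| ≤ w_j for all j implies ‖u‖ ≤ ‖w‖), as all weighted p-norms are; for an arbitrary norm the bound can fail, e.g. ‖(a,b)‖ = 7|a−b|+|a+b|, f = 7|a−b| on [0,1]², ε = 5, λ = 1/2. *)

(* Defs.v *)
From HB Require Import structures.
From mathcomp Require Import all_boot all_order all_algebra.
From mathcomp Require Import all_classical all_reals all_analysis.

Set Implicit Arguments.
Unset Strict Implicit.
Unset Printing Implicit Defensive.

Import Order.TTheory GRing.Theory Num.Theory.
Import numFieldNormedType.Exports.

Local Open Scope classical_set_scope.
Local Open Scope ring_scope.

Definition cv_le (R : realType) (d : nat) (u v : 'cV[R]_d) : Prop :=
  forall j, u j 0 <= v j 0.

Notation "u <=cv v" := (cv_le u v) (at level 70, no associativity).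

Definition minimizer (R : realType) (T : Type) (D : set T) (g : T -> R)
    (x : T) : Prop :=
  D x /\ forall y, D y -> g x <= g y.

(* The first [ncont] variables are continuous, the last [nint] are integer.
   [arg i] is the index set I_i, [out i] the index r_i, and [fn i] takes a
   vector of length l_i = #|arg i|. *)
Record problem (R : realType) := Problem {
  ncont : nat;
  nint : nat;
  ncstr : nat;
  nfun : nat;
  cost : 'cV[R]_(ncont + nint);
  cmat : 'M[R]_(ncstr, ncont + nint);
  crhs : 'cV[R]_ncstr;
  xlo : 'cV[R]_(ncont + nint);
  xhi : 'cV[R]_(ncont + nint);
  xlo_int : forall j, xlo (rshift ncont j) 0 \is a Num.int;
  xhi_int : forall j, xhi (rshift ncont j) 0 \is a Num.int;
  arg : 'I_nfun -> {set 'I_ncont};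
  out : 'I_nfun -> 'I_ncont;
  out_notin : forall i, out i \notin arg i;
  fn : forall i, 'cV[R]_#|arg i| -> R;
  fn_lipschitz : forall i, lipschitz (@fn i : 'cV[R]_#|arg i| -> R^o)
}.

Arguments fn {R p} i _.

Definition xspace (R : realType) (P : problem R) :=
  'cV[R]_(ncont P + nint P).

(* x_{I_i}, with the indices of I_i in increasing order. *)
Definition xarg (R : realType) (P : problem R) (x : xspace P) (i : 'I_(nfun P)) :
    'cV[R]_#|arg i| :=
  \col_(k < #|arg i|) x (lshift (nint P) (enum_val k)) 0.

Definition xout (R : realType) (P : problem R) (x : xspace P) (i : 'I_(nfun P)) :
    R :=
  x (lshift (nint P) (out i)) 0.

Record is_norm (R : realType) (d : nat) (N : 'cV[R]_d -> R) : Prop := IsNorm {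
  norm_triangle : forall u v, N (u + v) <= N u + N v;
  norm_homogeneous : forall a u, N (a *: u) = `|a| * N u;
  norm_definite : forall u, N u = 0 -> u = 0
}.

(* Equivalently: every point of a box is within half the length of the diagonal
   of the midpoint of the box, as the definition of [Omega] below presupposes.
   All weighted p-norms have this property, but not all norms do: for
   N (a, b) = 5 |a - b| + |a + b| and the box [0, 1]^2, half the diagonal has
   length 1, but (0, 1) has distance 5 from the midpoint. *)
Definition box_monotone (R : realType) (d : nat) (N : 'cV[R]_d -> R) : Prop :=
  forall u w : 'cV[R]_d, (forall j, `|u j 0| <= w j 0) -> N u <= N w.

(* The box B(v, w) is represented by the pair (v, w). *)
Definition box (R : realType) (d : nat) := ('cV[R]_d * 'cV[R]_d)%type.

Definition in_box (R : realType) (d : nat) (b : box R d) : set 'cV[R]_d :=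
  [set y | b.1 <=cv y /\ y <=cv b.2].

Definition midpoint (R : realType) (d : nat) (b : box R d) : 'cV[R]_d :=
  2^-1 *: (b.1 + b.2).

Definition shrink (R : realType) (lam : R) (d : nat) (b : box R d) : box R d :=
  ((1 - lam) *: b.1 + lam *: b.2, lam *: b.1 + (1 - lam) *: b.2).

Definition split_box (R : realType) (d : nat) (b : box R d) (y : 'cV[R]_d) :
    set (box R d) :=
  [set w : box R d | forall j,
    (w.1 j 0 = b.1 j 0 /\ w.2 j 0 = y j 0) \/
    (w.1 j 0 = y j 0 /\ w.2 j 0 = b.2 j 0)].

Definition arg_box (R : realType) (P : problem R) (i : 'I_(nfun P)) :
    box R #|arg i| :=
  (xarg (xlo P) i, xarg (xhi P) i).

(* [lip i] may be any valid Lipschitz constant, in particular the least one. *)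
Record relaxation (R : realType) (P : problem R) := Relaxation {
  nrm : forall i : 'I_(nfun P), 'cV[R]_#|arg i| -> R;
  nrm_norm : forall i, is_norm (@nrm i);
  nrm_monotone : forall i, box_monotone (@nrm i);
  lip : 'I_(nfun P) -> R;
  lip_ge0 : forall i, 0 <= lip i;
  lip_arg_box : forall i y z, in_box (arg_box i) y -> in_box (arg_box i) z ->
    `|fn i y - fn i z| <= lip i * @nrm i (y - z)
}.

Arguments nrm {R P} r i _.

Definition box_family (R : realType) (P : problem R) :=
  forall i : 'I_(nfun P), set (box R #|arg i|).

(* The sequences of the box families, the points x^k, the boxes selected by the
   indices j_i^k, and the solutions of the subproblems. *)
Record trace (R : realType) (P : problem R) := Trace {
  boxes : nat -> box_family P;
  sol : nat -> xspace P;
  sel : nat -> forall i : 'I_(nfun P), box R #|arg i|;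
  subsol : nat -> xspace P
}.

Arguments boxes {R P} t _ i _.

Section algorithm.
Variables (R : realType) (P : problem R) (X : relaxation P) (eps lam : R).

Definition Omega (i : 'I_(nfun P)) (b : box R #|arg i|) :
    set ('cV[R]_#|arg i| * R) :=
  [set yt | in_box b yt.1 /\
    `|yt.2 - fn i (midpoint b)| <= 2^-1 * lip X i * nrm X i (b.2 - b.1)].

Definition Omega_shrunk (i : 'I_(nfun P)) (b : box R #|arg i|) :
    set ('cV[R]_#|arg i| * R) :=
  Omega b `&` [set yt | in_box (shrink lam b) yt.1].

Definition master_feasible (F : box_family P) : set (xspace P) :=
  [set x | [/\ crhs P <=cv cmat P *m x,
               xlo P <=cv x /\ x <=cv xhi P,
               forall j, x (rshift (ncont P) j) 0 \is a Num.int &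
               forall i, exists2 b, F i b & Omega b (xarg x i, xout x i)]].

Definition master_solution (F : box_family P) (x : xspace P) : Prop :=
  minimizer (master_feasible F) (fun y => ((cost P)^T *m y) 0 0) x.

Definition sub_feasible (b : forall i : 'I_(nfun P), box R #|arg i|) :
    set (xspace P) :=
  [set y | forall i, fn i (xarg y i) = xout y i /\
                     Omega_shrunk (b i) (xarg y i, xout y i)].

Definition sub_solution (b : forall i : 'I_(nfun P), box R #|arg i|)
    (x y : xspace P) : Prop :=
  minimizer (sub_feasible b) (fun z => \sum_j (z j 0 - x j 0) ^+ 2) y.

Definition violated (x : xspace P) (i : 'I_(nfun P)) : bool :=
  eps < `|fn i (xarg x i) - xout x i|.

Definition refine (F : box_family P) (b : forall i : 'I_(nfun P), box R #|arg i|)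
    (x y : xspace P) : box_family P :=
  fun i => if violated x i then (F i `\ b i) `|` split_box (b i) (xarg y i)
           else F i.

Definition initialized (tr : trace P) : Prop :=
  forall i, boxes tr 0 i = [set arg_box i].

Definition stops (tr : trace P) (k : nat) : Prop :=
  master_feasible (boxes tr k) = set0 \/
  (master_solution (boxes tr k) (sol tr k) /\
   forall i, ~~ violated (sol tr k) i).

(* Iteration k is carried out to its end, without stopping. *)
Definition completes (tr : trace P) (k : nat) : Prop :=
  [/\ master_solution (boxes tr k) (sol tr k),
      exists i, violated (sol tr k) i,
      forall i, boxes tr k i (sel tr k i) /\
        Omega (sel tr k i) (xarg (sol tr k) i, xout (sol tr k) i),
      sub_solution (sel tr k) (sol tr k) (subsol tr k) &
      boxes tr k.+1 = refine (boxes tr k) (sel tr k) (sol tr k) (subsol tr k)].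

Definition reaches (tr : trace P) (k : nat) : Prop :=
  initialized tr /\ forall k', (k' < k)%N -> completes tr k'.

(* Nothing is required of the sequences after the stopping iteration. *)
Definition execution (tr : trace P) : Prop :=
  initialized tr /\
  forall k, reaches tr k -> stops tr k \/ completes tr k.

(* If the Lipschitz constant or the diagonal of the initial box vanishes, the
   logarithm below is undefined on paper; here eps / 0 = 0 and ln 0 = 0 give
   depth_bound i = 0. *)
Definition depth_bound (i : 'I_(nfun P)) : int :=
  Num.ceil (ln (eps / (lip X i * nrm X i (xarg (xhi P) i - xarg (xlo P) i)))
            / ln (1 - lam)).

(* The inner sum over 0 <= k <= depth_bound i is empty if depth_bound i < 0. *)
Definition iteration_bound : nat :=
  (\sum_(i < nfun P)
     match depth_bound i with
     | Posz s => \sum_(0 <= k < s.+1) 2 ^ (k * #|arg i|)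
     | Negz _ => 0
     end)%N.

End algorithm.

(* Main.v *)
Require Import Defs.
From mathcomp Require Import all_boot all_order all_algebra.
From mathcomp Require Import all_classical all_reals all_analysis.
From mathcomp Require Import lra.

Set Implicit Arguments.
Unset Strict Implicit.
Unset Printing Implicit Defensive.

Import Order.TTheory GRing.Theory Num.Theory.
Local Open Scope ring_scope.

(** Give every box [b] of function [i] a number [n] of levels after which
    repeated splitting certainly makes the product of the Lipschitz constant and
    the diagonal at most [eps], that is [L * |b| * (1 - lam) ^ n <= eps].  A
    split at a point of the shrunk box multiplies the diagonal by at most
    [1 - lam] in any monotone norm, so the [2 ^ l] children of [b] can be given
    [n - 1] levels ([levels_suffice_split]).  A box that contains the arguments
    of a violated point has at least one level left, because a point of
    [Omega b] misses the graph of the function by at most [L * |b|]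
    ([Omega_residual]), while for zero levels this product is at most [eps].

    Hence the total number of inner nodes [1 + 2 ^ l + ... + 2 ^ (l (n - 1))] of
    the complete trees of these heights, summed over the boxes of a family,
    drops by at least one whenever a violated constraint has its box split
    ([refinement_budget_split]).  Every iteration that does not stop violates
    some constraint, so the number of iterations is at most the sum of the
    initial budgets.  The logarithm in the definition of the depth bound is
    chosen so that the bound is a valid number of levels for the initial box
    ([depth_bound_suffices]).

    Since the budget is an upper bound on a weighted count, it is harmless if
    two boxes of a family coincide: no tree of boxes has to be kept, nor must
    the children be shown to differ from each other or from their parent. *)

(** * Counting splits by a decreasing budget *)

(** The number of inner nodes of the complete [a]-ary tree of height [n]. *)
Definition tree_size (a n : nat) : nat := (\sum_(0 <= k < n) a ^ k)%N.

Lemma tree_sizeS a n : tree_size a n.+1 = (1 + a * tree_size a n)%N.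
Proof.
rewrite /tree_size big_nat_recl // expn0 big_distrr /=; congr addn.
by apply: eq_bigr => k _; rewrite expnS.
Qed.

(** [E b n] is to be read as: [n] levels of splitting suffice below [b].  The
    witness is a list, in which repetitions are allowed and only the elements
    of [F] have to occur, so that sums over sets are avoided. *)
Definition refinement_budget (T : eqType) (a : nat) (E : T -> nat -> Prop)
    (F : set T) (n : nat) : Prop :=
  exists s : seq (T * nat),
    [/\ forall b, F b -> b \in [seq p.1 | p <- s],
        forall p, p \in s -> E p.1 p.2 &
        (\sum_(p <- s) tree_size a p.2 <= n)%N].

(** A tree of height [m + 1] has one inner node more than the [a] trees of
    height [m] below its root; this node pays for the split. *)
Lemma refinement_budget_split (T : eqType) (a : nat) (E : T -> nat -> Prop)
    (F : set T) (n : nat) (b : T) (cs : seq T) :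
  refinement_budget a E F n -> F b -> ~ E b 0%N -> (size cs <= a)%N ->
  (forall m c, E b m.+1 -> c \in cs -> E c m) ->
  (0 < n)%N /\
  refinement_budget a E ((F `\ b) `|` [set` cs])%classic n.-1.
Proof.
move=> [s [Fs Es sn]] Fb nE0 csa Ecs.
have /mapP[[b' [|m]] ps /= eb] := Fs _ Fb.
  by case: nE0; rewrite eb; exact: (Es _ ps).
rewrite -{b'}eb in ps.
have sum_s := perm_big _ (perm_to_rem ps).
rewrite sum_s big_cons /= tree_sizeS in sn.
split; first by apply: leq_trans sn; rewrite -addnA add1n.
exists (rem (b, m.+1) s ++ [seq (c, m) | c <- cs]); split.
- move=> c [[/Fs /mapP[[c' k] cs' /= ->] cb]|/= ccs].
    rewrite map_cat mem_cat; apply/orP; left; apply/mapP; exists (c', k) => //.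
    have := cs'; rewrite (perm_mem (perm_to_rem ps)) inE => /orP[/eqP[ec _]|//].
    by case: cb.
  rewrite map_cat mem_cat; apply/orP; right.
  by rewrite -map_comp map_id.
- move=> p; rewrite mem_cat => /orP[/mem_rem/Es//|/mapP[c ccs ->] /=].
  exact: Ecs (Es _ ps) ccs.
- rewrite big_cat big_map /= big_const_seq count_predT iter_addn_0.
  have -> : n = n.-1.+1 by case: (n) sn.
  move: sn; case: (n) => [//|n']; rewrite /= -addnA add1n ltnS => sn.
  apply: leq_trans sn; rewrite addnC leq_add2r mulnC leq_mul2r csa.
  by rewrite orbT.
Qed.

(** * Splitting a box shrinks its diagonal *)

Lemma norm_half (R : realType) (d : nat) (N : 'cV[R]_d -> R)
    (u : 'cV[R]_d) :
  is_norm N -> N (2^-1 *: u) = 2^-1 * N u.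
Proof. by move=> [_ -> _]; rewrite ger0_norm // invr_ge0. Qed.

(** A child of [b] is determined by choosing the lower or the upper half in
    each coordinate. *)
Lemma split_box_enum (R : realType) (d : nat) (b : box R d) (y : 'cV[R]_d) :
  exists2 cs : seq (box R d), size cs = (2 ^ d)%N &
    split_box b y = [set` cs]%classic.
Proof.
pose child (h : {ffun 'I_d -> bool}) : box R d :=
  (\col_j (if h j then b.1 j 0 else y j 0),
   \col_j (if h j then y j 0 else b.2 j 0)).
exists [seq child h | h <- enum {ffun 'I_d -> bool}].
  by rewrite size_map -cardE card_ffun card_bool card_ord.
apply/seteqP; split => [[w1 w2] /= wP|w /= /mapP[h _ ->] j] /=; last first.
  by rewrite !mxE; case: (h j); [left|right].
apply/mapP; exists [ffun j => (w1 j 0 == b.1 j 0) && (w2 j 0 == y j 0)].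
  by rewrite mem_enum.
congr pair; apply/matrixP => j k; rewrite ord1 !mxE ffunE;
  case: ifP => [/andP[/eqP e1 /eqP e2]|]; rewrite ?e1 ?e2 //;
  by case: (wP j) => /= -[-> ->] //; rewrite !eqxx.
Qed.

Lemma split_box_sub (R : realType) (d : nat) (b c : box R d) (y : 'cV[R]_d) :
  in_box b y -> split_box b y c -> b.1 <=cv c.1 /\ c.2 <=cv b.2.
Proof.
move=> [b1y yb2] bc; split=> j; have := b1y j; have := yb2 j;
  by case: (bc j) => -[e1 e2]; rewrite ?e1 ?e2.
Qed.

(** In each coordinate the split point is at least [lam] times the width away
    from both ends, so both halves have at most [1 - lam] times the width. *)
Lemma split_box_diag (R : realType) (lam : R) (d : nat) (N : 'cV[R]_d -> R)
    (b c : box R d) (y : 'cV[R]_d) :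
  is_norm N -> box_monotone N -> lam <= 1 ->
  in_box b y -> in_box (shrink lam b) y -> split_box b y c ->
  N (c.2 - c.1) <= (1 - lam) * N (b.2 - b.1).
Proof.
move=> [_ Nhom _] Nmon lam1 [b1y yb2] [s1y ys2] bc.
rewrite -[1 - lam]ger0_norm ?subr_ge0 // -Nhom; apply: Nmon => j.
move: (b1y j) (yb2 j) (s1y j) (ys2 j); rewrite !mxE => h1 h2 h3 h4.
by case: (bc j) => -[-> ->]; rewrite ger0_norm ?subr_ge0 //; lra.
Qed.

(** * Constraint residuals and remaining levels *)

Section residual.
Variables (R : realType) (P : problem R) (X : relaxation P).

(** Both [fn i y] and [t] are within half of the right-hand side of the value
    at the midpoint: the former by the Lipschitz property and monotonicity of
    the norm, the latter by definition of [Omega].  The Lipschitz constant is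
    valid on the initial box only, so [b] has to lie there. *)
Lemma Omega_residual (i : 'I_(nfun P)) (b : box R #|arg i|)
    (y : 'cV[R]_#|arg i|) (t : R) :
  (arg_box i).1 <=cv b.1 -> b.2 <=cv (arg_box i).2 -> Omega X b (y, t) ->
  `|fn i y - t| <= lip X i * nrm X i (b.2 - b.1).
Proof.
move=> lo hi [[/= b1y yb2] tm].
have ym : `|fn i y - fn i (midpoint b)| <=
    lip X i * (2^-1 * nrm X i (b.2 - b.1)).
  apply: le_trans (lip_arg_box (i := i) X _ _) _.
  - by split=> j; [apply: le_trans (lo j) (b1y j)|apply: le_trans (hi j)].
  - split=> j; move: (lo j) (hi j) (b1y j) (yb2 j); rewrite !mxE; lra.
  rewrite ler_wpM2l ?lip_ge0 // -(norm_half _ (nrm_norm X i)).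
  apply: nrm_monotone => j.
  by move: (b1y j) (yb2 j); rewrite !mxE ler_norml => h1 h2; apply/andP; lra.
have -> : fn i y - t = (fn i y - fn i (midpoint b)) - (t - fn i (midpoint b)).
  by rewrite opprB addrA subrK.
apply: le_trans (ler_normB _ _) _; lra.
Qed.

(** The restriction to sub-boxes of the initial box makes the Lipschitz
    constant applicable. *)
Definition levels_suffice (eps lam : R) (i : 'I_(nfun P)) (b : box R #|arg i|)
    (n : nat) : Prop :=
  [/\ (arg_box i).1 <=cv b.1, b.2 <=cv (arg_box i).2 &
      lip X i * nrm X i (b.2 - b.1) * (1 - lam) ^+ n <= eps].

Lemma levels_suffice_split (eps lam : R) (i : 'I_(nfun P))
    (b c : box R #|arg i|) (y : 'cV[R]_#|arg i|) (t : R) (n : nat) :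
  lam <= 1 -> levels_suffice eps lam b n.+1 -> Omega_shrunk X lam b (y, t) ->
  split_box b y c -> levels_suffice eps lam c n.
Proof.
move=> lam1 [lo hi bn] [[/= yb _] ys] bc.
have [b1c cb2] := split_box_sub yb bc.
split; [by move=> j; apply: le_trans (b1c j)| |].
  by move=> j; apply: le_trans (cb2 j) (hi j).
apply: le_trans bn; rewrite exprS mulrA.
apply: ler_wpM2r; first by rewrite exprn_ge0 // subr_ge0.
rewrite -mulrA; apply: ler_wpM2l; first exact: lip_ge0.
rewrite mulrC; apply: (split_box_diag _ _ _ yb ys bc) => //.
  exact: nrm_norm.
exact: nrm_monotone.
Qed.

Lemma violated_levels (eps lam : R) (x : xspace P) (i : 'I_(nfun P))
    (b : box R #|arg i|) :
  Omega X b (xarg x i, xout x i) -> violated eps x i ->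
  ~ levels_suffice eps lam b 0.
Proof.
move=> xb viol [lo hi]; rewrite expr0 mulr1 leNgt => /negP; apply.
exact: lt_le_trans viol (Omega_residual lo hi xb).
Qed.

(** If the scaled diagonal [A] of the initial box is positive, the inequality
    [ln (eps / A) / ln (1 - lam) <= n] means [(1 - lam) ^ n <= eps / A], the
    logarithm of [1 - lam] being negative; otherwise any number of levels
    suffices. *)
Lemma depth_bound_suffices (eps lam : R) (i : 'I_(nfun P)) (n : nat) :
  0 < eps -> 0 < lam -> lam < 1 -> depth_bound X eps lam i <= n%:Z ->
  levels_suffice eps lam (arg_box i) n.
Proof.
move=> eps0 lam0 lam1 dn; split=> //=.
set A := lip X i * _; have q0 : 0 < 1 - lam by rewrite subr_gt0.
have [A0|A0] := leP A 0.
  by apply: le_trans (ltW eps0); rewrite mulr_le0_ge0 // exprn_ge0 // ltW.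
rewrite mulrC -ler_pdivlMr // -ler_ln ?posrE ?exprn_gt0 ?divr_gt0 //.
rewrite lnXn // -mulr_natl.
have lnq : ln (1 - lam) < 0 by rewrite ln_lt0 // q0 /= gtrBl.
rewrite -ler_ndivrMr //.
by apply: le_trans (ceil_ge _) _; rewrite -[n%:R]/(n%:Z%:~R) ler_int.
Qed.

End residual.

(** * Termination *)

Section termination.
Variables (R : realType) (P : problem R) (X : relaxation P) (eps lam : R).
Hypotheses (eps_gt0 : 0 < eps) (lam_gt0 : 0 < lam) (lam_lt1 : lam < 1).

Let budget (F : box_family P) (n : 'I_(nfun P) -> nat) : Prop :=
  forall i, refinement_budget (2 ^ #|arg i|)
    (@levels_suffice _ _ X eps lam i) (F i) (n i).

Lemma initial_budget (tr : trace P) : initialized tr ->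
  exists2 n, budget (boxes tr 0) n &
    (\sum_i n i <= iteration_bound X eps lam)%N.
Proof.
move=> tr0; exists (fun i => tree_size (2 ^ #|arg i|)
    (if depth_bound X eps lam i is Posz s then s else 0)).
  move=> i; exists [:: (arg_box i,
      if depth_bound X eps lam i is Posz s then s else 0%N)]; split.
  - by move=> b; rewrite tr0 /= => ->; rewrite inE eqxx.
  - move=> p; rewrite inE => /eqP -> /=.
    by apply: depth_bound_suffices => //; case: (depth_bound _ _ _ _).
  - by rewrite big_seq1.
apply: leq_sum => i _; case: (depth_bound _ _ _ _) => [s|s]; last first.
  by rewrite /tree_size big_geq.
(* The inner nodes of a tree of height [s] lie on the levels 0 to [s - 1]; the
   bound also counts the leaves on level [s]. *)
rewrite [leqRHS]big_nat_recr //=; apply: leq_trans (leq_addr _ _).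
by apply: leq_sum => k _; rewrite mulnC expnM.
Qed.

(** At least one constraint is violated in a completed iteration; the budgets of
    exactly the violated ones are lowered by one. *)
Lemma completes_budget (tr : trace P) (k : nat) (n : 'I_(nfun P) -> nat) :
  completes X eps lam tr k -> budget (boxes tr k) n ->
  exists2 n', budget (boxes tr k.+1) n' & (\sum_i n' i < \sum_i n i)%N.
Proof.
move=> [_ [i0 viol0] sel_ok [sub_ok _] boxesS] bn.
have step i : violated eps (sol tr k) i -> (0 < n i)%N /\
    refinement_budget (2 ^ #|arg i|) (@levels_suffice _ _ X eps lam i)
      (boxes tr k.+1 i) (n i).-1.
  move=> viol; rewrite boxesS /refine viol.
  have [selF selO] := sel_ok i; have [_ subO] := sub_ok i.
  have [cs size_cs cs_split] :=
    split_box_enum (sel tr k i) (xarg (subsol tr k) i).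
  rewrite cs_split; apply: refinement_budget_split => //.
  - exact: violated_levels selO viol.
  - by rewrite size_cs.
  - move=> m c selm ccs; apply: levels_suffice_split selm subO _.
      exact: ltW.
    by rewrite cs_split.
exists (fun i => (n i - violated eps (sol tr k) i)%N).
  move=> i; case viol: (violated _ _ _).
    by have [_] := step _ viol; rewrite subn1.
  by rewrite subn0 boxesS /refine viol; exact: bn.
rewrite (bigD1 i0) //= [ltnRHS](bigD1 i0) //= -addSn viol0 subn1.
rewrite prednK; last by have [] := step _ viol0.
by rewrite leq_add2l; apply: leq_sum => i _; exact: leq_subr.
Qed.

Lemma reaches_bound (tr : trace P) (k : nat) :
  reaches X eps lam tr k -> (k <= iteration_bound X eps lam)%N.
Proof.
move=> [tr0 compl]; have [n0 bn0 n0K] := initial_budget tr0.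
(* Iterations done plus remaining budget never increases. *)
suff [n _ nk] : exists2 n, budget (boxes tr k) n &
    (k + \sum_i n i <= iteration_bound X eps lam)%N.
  exact: leq_trans (leq_addr _ _) nk.
elim: k compl => [|k IH] compl; first by exists n0.
have [n bn nk] := IH (fun k' lt_k' => compl k' (ltnW lt_k')).
have [n' bn' n'n] := completes_budget (compl k (ltnSn k)) bn.
by exists n' => //; apply: leq_trans nk; rewrite addSnnS leq_add2l.
Qed.

End termination.

Theorem theorem3p7 (R : realType) (P : problem R) (X : relaxation P)
    (eps lam : R) (eps_gt0 : 0 < eps) (lam_gt0 : 0 < lam)
    (lam_le : lam <= 2^-1) (tr : trace P) :
  (forall k, reaches X eps lam tr k -> (k <= iteration_bound X eps lam)%N) /\
  (execution X eps lam tr ->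
   exists k, [/\ (k <= iteration_bound X eps lam)%N,
                 reaches X eps lam tr k & stops X eps tr k]).
Proof.
have lam_lt1 : lam < 1 by lra.
have bound k : reaches X eps lam tr k -> (k <= iteration_bound X eps lam)%N.
  exact: reaches_bound.
split=> // -[tr0 exec]; apply: contrapT => nostop.
(* An execution that never stops would reach every iteration. *)
have reach k : reaches X eps lam tr k.
  elim: k => [|k IH]; first by split.
  have [stop|compl] := exec k IH.
    by case: nostop; exists k; split=> //; exact: bound.
  split=> // k'; rewrite ltnS leq_eqVlt => /orP[/eqP -> //|].
  exact: IH.2.
by have := bound _ (reach (iteration_bound X eps lam).+1); rewrite ltnn.
Qed.
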